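(* Let $R$ be a binary relation on a set $A$ and $x\in A$. (1) If $x\in\mathrm{WN}$, $x\in\mathrm{NP}^{\to}$ and $x\in\mathrm{SM}$, then $x\in\mathrm{SN}$. (2) If every element of $A$ is in $\mathrm{WN}$, then every $x\in\mathrm{SM}$ is in $\mathrm{SN}$; in particular, if every element is in $\mathrm{WN}$ and every element is in $\mathrm{SM}$, then every element is in $\mathrm{SN}$. (Constructively.)
   Context: Work in constructive (intuitionistic) logic / Martin-Löf type theory without excluded middle or other axioms. Let $R$ be a binary relation on $A$; write $a\to b$ for $R\,a\,b$ and $\to^*$ for its reflexive–transitive closure. $a\in\mathrm{NF}$ iff there is no $b$ with $a\to b$. $a\in\mathrm{WN}$ iff $a\to^* b$ for some $b\in\mathrm{NF}$. $\mathrm{SN}$ is defined inductively: $a\in\mathrm{SN}$ if every $b$ with $a\to b$ is in $\mathrm{SN}$. $a\in\mathrm{NP}^{\to}$ iff for all $c\in A$ and $b\in\mathrm{NF}$, $a\to^* c$ and $a\to^* b$ imply $c\to^* b$. $a\in\mathrm{MF}$ iff for all $b$, $a\to^* b$ implies $b\to^* a$. $\mathrm{SM}$ is defined inductively by two rules: if $a\in\mathrm{MF}$ then $a\in\mathrm{SM}$; and if every $b$ with $a\to b$ is in $\mathrm{SM}$ then $a\in\mathrm{SM}$. *)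

(* Defs.v *)
From Stdlib Require Import Relations.

Section Rewriting.
Variable A : Type.
Variable R : A -> A -> Prop.

Definition RT : A -> A -> Prop := clos_refl_trans A R.

Definition NF (a : A) : Prop := ~ (exists b, R a b).

Definition WN (a : A) : Prop := exists b, RT a b /\ NF b.

Inductive SN : A -> Prop :=
  | SN_intro : forall a, (forall b, R a b -> SN b) -> SN a.

Definition NP (a : A) : Prop :=
  forall c b, NF b -> RT a c -> RT a b -> RT c b.

Definition MF (a : A) : Prop := forall b, RT a b -> RT b a.

Inductive SM : A -> Prop :=
  | SM_MF : forall a, MF a -> SM a
  | SM_step : forall a, (forall b, R a b -> SM b) -> SM a.

End Rewriting.

Arguments RT {A} R.
Arguments NF {A} R.
Arguments WN {A} R.
Arguments SN {A} R.
Arguments NP {A} R.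
Arguments MF {A} R.
Arguments SM {A} R.

(* Main.v *)
(* A state with the minimal-form property that can reach a normal form n must
   be n itself, since n reaches it back; so it is strongly normalizing.  An
   SM-derivation therefore ends in normal forms, and SN follows by induction
   on SM, provided WN is inherited by every successor: either because all
   terms are WN, or because NP forces the normal form of x to stay reachable
   from every reduct of x (and NP is itself inherited by reducts). *)
Require Import Defs.
From Stdlib Require Import Relations.

Section Normalization.
Variable A : Type.
Variable R : A -> A -> Prop.

Lemma NF_RT_eq (b y : A) : NF R b -> RT R b y -> y = b.
Proof.
  intros Hnf Hby; apply clos_rt_rt1n in Hby.
  destruct Hby as [|z ? Hbz _]; [reflexivity|].
  exfalso; apply Hnf; exists z; exact Hbz.
Qed.

Lemma NF_SN (x : A) : NF R x -> SN R x.
Proof.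
  intros Hnf; constructor; intros y Hxy.
  exfalso; apply Hnf; exists y; exact Hxy.
Qed.

Lemma MF_WN_NF (x : A) : WN R x -> MF R x -> NF R x.
Proof.
  intros [n [Hxn Hnf]] Hmf.
  rewrite (NF_RT_eq n x Hnf (Hmf n Hxn)); exact Hnf.
Qed.

Lemma NP_RT (x y : A) : NP R x -> RT R x y -> NP R y.
Proof.
  intros Hnp Hxy c n Hnf Hyc Hyn.
  apply (Hnp c n Hnf); apply rt_trans with y; assumption.
Qed.

Lemma WN_RT (x y : A) : NP R x -> WN R x -> RT R x y -> WN R y.
Proof.
  intros Hnp [n [Hxn Hnf]] Hxy.
  exists n; split; [exact (Hnp y n Hnf Hxy Hxn) | exact Hnf].
Qed.

Lemma SM_WN_NP_SN (x : A) : SM R x -> WN R x -> NP R x -> SN R x.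
Proof.
  induction 1 as [x Hmf | x _ IH]; intros Hwn Hnp.
  - exact (NF_SN x (MF_WN_NF x Hwn Hmf)).
  - constructor; intros y Hxy.
    assert (Hrt : RT R x y) by (apply rt_step; exact Hxy).
    exact (IH y Hxy (WN_RT x y Hnp Hwn Hrt) (NP_RT x y Hnp Hrt)).
Qed.

Lemma SM_SN_of_WN : (forall a, WN R a) -> forall x, SM R x -> SN R x.
Proof.
  intros Hwn x; induction 1 as [x Hmf | x _ IH].
  - exact (NF_SN x (MF_WN_NF x (Hwn x) Hmf)).
  - constructor; exact IH.
Qed.

End Normalization.

Theorem mainTheorem10 (A : Type) (R : A -> A -> Prop) :
  (forall x : A, WN R x -> NP R x -> SM R x -> SN R x) /\
  ((forall a : A, WN R a) -> forall x : A, SM R x -> SN R x) /\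
  ((forall a : A, WN R a) -> (forall a : A, SM R a) -> forall x : A, SN R x).
Proof.
  split; [|split].
  - intros x Hwn Hnp Hsm; exact (SM_WN_NP_SN A R x Hsm Hwn Hnp).
  - exact (SM_SN_of_WN A R).
  - intros Hwn Hsm x; exact (SM_SN_of_WN A R Hwn x (Hsm x)).
Qed.
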